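(* Let $G^*$ be a $p$-vertex DAG, let $\sigma$ be a permutation of $[p]$, let $G^*_\sigma$ be the minimal I-map of $G^*$ with ordering $\sigma$, and let $d^*_\sigma=\max_{j\in[p]}|\mathrm{Pa}_j(G^*_\sigma)\cup\mathrm{Ch}_j(G^*_\sigma)|$ be the maximum degree of $G^*_\sigma$. Let $d_{\mathrm{in}},d_{\mathrm{out}}\in[p]$ satisfy $d^*_\sigma\le d_{\mathrm{in}}$ and $\min\{d^*_\sigma d_{\mathrm{in}}+1,\,p\}\le d_{\mathrm{out}}$. Then for any $G\in\mathcal G_p^\sigma(d_{\mathrm{in}},d_{\mathrm{out}})$ such that $G\ne G^*_\sigma$, there exists some $j\in[p]$ such that $g_j^\sigma(G)\in\mathcal G_p^\sigma(d_{\mathrm{in}},d_{\mathrm{out}})$ and $g_j^\sigma(G)\ne G$, where $g_j^\sigma$ is the nodewise add-delete-swap operator defined in the context.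
   Context: $[p]=\{1,\dots,p\}$; all DAGs have vertex set $[p]$. $\mathrm{Pa}_j(G)$ and $\mathrm{Ch}_j(G)$ are the sets of parents and children of node $j$ in $G$. For a permutation $\sigma$ of $[p]$, $\mathcal G_p^\sigma$ is the set of DAGs having $\sigma$ as a topological ordering, i.e. $\sigma(j)\to\sigma(i)\notin G$ for any $i<j$. $\mathcal G_p^\sigma(d_{\mathrm{in}},d_{\mathrm{out}})$ is the set of $G\in\mathcal G_p^\sigma$ with $\max_j|\mathrm{Pa}_j(G)|\le d_{\mathrm{in}}$ and $\max_j|\mathrm{Ch}_j(G)|\le d_{\mathrm{out}}$. Minimal I-map: $G^*_\sigma\in\mathcal G_p^\sigma$ is the DAG such that for $i<j$, $\sigma(i)\to\sigma(j)\in G^*_\sigma$ if and only if nodes $\sigma(i),\sigma(j)$ are not conditionally independent (not d-separated in $G^*$) given $\{\sigma(1),\dots,\sigma(j-1)\}\setminus\{\sigma(i)\}$. Score: $\psi$ is a real-valued function on DAGs that is decomposable, $\psi(G)=\sum_{j\in[p]}\psi_j(\mathrm{Pa}_j(G))$ with $\psi_j\colon2^{[p]}\to\mathbb R$, and score equivalent ($\psi(G)=\psi(G')$ for Markov equivalent $G,G'$). Let $\mathcal A_p^\sigma(j)=\{k\in[p]\colon\sigma^{-1}(k)<\sigma^{-1}(j)\}$ and $\mathcal M_p^\sigma(j,d_{\mathrm{in}})=\{S\subseteq\mathcal A_p^\sigma(j)\colon|S|\le d_{\mathrm{in}}\}$. Operators: assume $G^*_\sigma\in\mathcal G_p^\sigma(d_{\mathrm{in}},d_{\mathrm{out}})$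 (which follows from the degree hypotheses in the claim) and let $S^*_{\sigma,j}=\mathrm{Pa}_j(G^*_\sigma)$. For $S\in\mathcal M_p^\sigma(j,d_{\mathrm{in}})$, put $T=S^*_{\sigma,j}\setminus S$, $R=S\setminus S^*_{\sigma,j}$, and define $g_j^\sigma(S)\in\mathcal M_p^\sigma(j,d_{\mathrm{in}})$ by (i) if $S=S^*_{\sigma,j}$, $g_j^\sigma(S)=S^*_{\sigma,j}$; (ii) if $S^*_{\sigma,j}\subsetneq S$, $g_j^\sigma(S)=S\setminus\{\tilde\ell\}$ with $\tilde\ell=\arg\max_{\ell\in R}\psi_j(S\setminus\{\ell\})$; (iii) if $S^*_{\sigma,j}\not\subseteq S$ and $|S|<d_{\mathrm{in}}$, $g_j^\sigma(S)=S\cup\{\tilde k\}$ with $\tilde k=\arg\max_{k\in T}\psi_j(S\cup\{k\})$; (iv) if $S^*_{\sigma,j}\not\subseteq S$ and $|S|=d_{\mathrm{in}}$, $g_j^\sigma(S)=(S\cup\{\tilde k\})\setminus\{\tilde\ell\}$ with $(\tilde k,\tilde\ell)=\arg\max_{(k,\ell)\in T\times R}\psi_j((S\cup\{k\})\setminus\{\ell\})$. (Ties in the argmax are broken by any fixed rule.) For a DAG $G$ with $\mathrm{Pa}_j(G)\in\mathcal M_p^\sigma(j,d_{\mathrm{in}})$, $g_j^\sigma(G)$ is the DAG with $\mathrm{Pa}_j(g_j^\sigma(G))=g_j^\sigma(\mathrm{Pa}_j(G))$ and $\mathrm{Pa}_i(g_j^\sigma(G))=\mathrm{Pa}_i(G)$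 for $i\ne j$. *)

(* Defs.v *)
From HB Require Import structures.
From mathcomp Require Import all_boot all_order all_fingroup all_algebra.
From mathcomp Require Import boolp reals.

Set Implicit Arguments.
Unset Strict Implicit.
Unset Printing Implicit Defensive.

Import Order.TTheory GRing.Theory Num.Theory.

Local Open Scope ring_scope.

(* The node set {1, ..., p} is 'I_p.  A directed graph is its edge set:
   (a, b) \in G means a -> b. *)
Definition digraph (p : nat) := {set 'I_p * 'I_p}.

Section Digraphs.
Variable p : nat.
Implicit Types (G : digraph p) (s : 'S_p) (A B C S : {set 'I_p}).

Definition edge G : rel 'I_p := [rel a b | (a, b) \in G].

Definition Pa G (j : 'I_p) : {set 'I_p} := [set k | (k, j) \in G].
Definition Ch G (j : 'I_p) : {set 'I_p} := [set k | (j, k) \in G].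

(* Directed cycles are closed walks of positive length; [:: x] is a self-loop. *)
Definition is_dag G : Prop :=
  forall c : seq 'I_p, c != [::] -> ~~ path.cycle (edge G) c.

(* s i is the node in position i of the ordering. *)
Definition ordered_dag s G : Prop :=
  is_dag G /\ forall i j : 'I_p, (i < j)%N -> (s j, s i) \notin G.

Definition bounded_ordered_dag s (d_in d_out : nat) G : Prop :=
  [/\ ordered_dag s G,
      (\max_(j < p) #|Pa G j| <= d_in)%N &
      (\max_(j < p) #|Ch G j| <= d_out)%N].

Definition max_degree G : nat := \max_(j < p) #|Pa G j :|: Ch G j|.

Definition adjacent G : rel 'I_p := [rel a b | edge G a b || edge G b a].

Definition collider G (u v w : 'I_p) : bool := edge G u v && edge G w v.

(* connect is reflexive, so the collider clause covers v and its descendants. *)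
Definition blocks_at G C (u v w : 'I_p) : bool :=
  if collider G u v w then [disjoint connect (edge G) v & C] else v \in C.

Definition blocked G C (t : seq 'I_p) : Prop :=
  exists u v w t1 t2, t = t1 ++ [:: u, v, w & t2] /\ blocks_at G C u v w.

Definition dsep G A B C : Prop :=
  forall (a : 'I_p) (t : seq 'I_p),
    a \in A -> last a t \in B -> path (adjacent G) a t -> uniq (a :: t) ->
    blocked G C (a :: t).

(* Two DAGs are Markov equivalent when they encode the same conditional
   independence (d-separation) relations. *)
Definition markov_equiv G G' : Prop :=
  forall A B C, [disjoint A & B] -> [disjoint A & C] -> [disjoint B & C] ->
    (dsep G A B C <-> dsep G' A B C).

Definition minimal_imap G s : digraph p :=
  [set (s i, s j) | i : 'I_p in 'I_p, j : 'I_p in 'I_p &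
     (i < j)%N &&
     `[< ~ dsep G [set s i] [set s j]
             ([set s k | k : 'I_p & (k < j)%N] :\ s i) >]].

Definition preds s (j : 'I_p) : {set 'I_p} :=
  [set k | ((s^-1)%g k < (s^-1)%g j)%N].

Definition cand_parents s (j : 'I_p) (d_in : nat) : {set {set 'I_p}} :=
  [set S : {set 'I_p} | (S \subset preds s j) && (#|S| <= d_in)%N].

End Digraphs.

Section Scores.
Variables (p : nat) (R : realType).

(* Scores are only constrained on acyclic graphs. *)
Definition decomposable (psi : digraph p -> R)
    (psi_ : 'I_p -> {set 'I_p} -> R) : Prop :=
  forall G, is_dag G -> psi G = \sum_(j < p) psi_ j (Pa G j).

Definition score_equivalent (psi : digraph p -> R) : Prop :=
  forall G G', is_dag G -> is_dag G' -> markov_equiv G G' -> psi G = psi G'.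

Definition is_argmax (T : finType) (A : {set T}) (f : T -> R) (x : T) : Prop :=
  x \in A /\ {in A, forall y, f y <= f x}.

(* ads_step f d_in Sstar S S': S' is an outcome of the add-delete-swap move at
   the parent set S, for the local score f and target parent set Sstar, under
   some resolution of the ties in the argmax. *)
Variant ads_step (f : {set 'I_p} -> R) (d_in : nat) (Sstar S : {set 'I_p}) :
    {set 'I_p} -> Prop :=
| AdsStay of S = Sstar : ads_step f d_in Sstar S Sstar
| AdsDelete l of Sstar \proper S
    & is_argmax (S :\: Sstar) (fun l' => f (S :\ l')) l :
    ads_step f d_in Sstar S (S :\ l)
| AdsAdd k of ~~ (Sstar \subset S) & (#|S| < d_in)%N
    & is_argmax (Sstar :\: S) (fun k' => f (k' |: S)) k :
    ads_step f d_in Sstar S (k |: S)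
| AdsSwap k l of ~~ (Sstar \subset S) & #|S| = d_in
    & is_argmax (setX (Sstar :\: S) (S :\: Sstar))
        (fun kl => f ((kl.1 |: S) :\ kl.2)) (k, l) :
    ads_step f d_in Sstar S ((k |: S) :\ l).

(* An arbitrary tie-breaking rule amounts to an arbitrary function g making
   one of the admissible moves at every candidate parent set. *)
Definition is_ads_operator (psi_ : 'I_p -> {set 'I_p} -> R) (s : 'S_p)
    (d_in : nat) (Gstar : digraph p) (g : 'I_p -> {set 'I_p} -> {set 'I_p}) :
    Prop :=
  forall (j : 'I_p) (S : {set 'I_p}), S \in cand_parents s j d_in ->
    ads_step (psi_ j) d_in (Pa (minimal_imap Gstar s) j) S (g j S).

End Scores.

Definition update_parents (p : nat) (g : 'I_p -> {set 'I_p} -> {set 'I_p})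
    (j : 'I_p) (G : digraph p) : digraph p :=
  [set e | if e.2 == j then e.1 \in g j (Pa G j) else e \in G].

(* Main.v *)
(** A move at [j] can only violate the out-degree bound by adding an edge
    [k j -> j] of the minimal I-map [H] whose source is already saturated in
    [G].  If no deletion is available and this happens at every node of
    [B = {j | Pa_j(G) <> Pa_j(H)}], let [K] be the set of all these sources.
    Outside [B] the edges of [G] leaving [K] are edges of [H], and at least
    [|B|] of the at most [d * |K|] edges of [H] leaving [K] end in [B]; hence [G]
    has at most [|B| * d_in + d * |K| - |B| <= d * d_in * |K|] edges leaving
    [K], fewer than the [(d * d_in + 1) * |K|] needed for saturation. *)

Require Import Defs.
From HB Require Import structures.
From mathcomp Require Import all_boot all_order all_fingroup all_algebra.
From mathcomp Require Import boolp reals.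
From mathcomp Require Import zify.

Set Implicit Arguments.
Unset Strict Implicit.
Unset Printing Implicit Defensive.

Import Order.TTheory GRing.Theory Num.Theory.

Local Open Scope ring_scope.

Section Digraphs.
Variable p : nat.
Implicit Types (G H : digraph p) (s : 'S_p) (S : {set 'I_p}).

(** Double counting: the edges from [K] to [B] are grouped by source on the left and by target on
    the right. *)
Lemma sum_card_Ch_Pa G (K B : {set 'I_p}) :
  (\sum_(v in K) #|Ch G v :&: B| = \sum_(j in B) #|Pa G j :&: K|)%N.
Proof.
have cardI (A C : {set 'I_p}) : #|A :&: C| = (\sum_(i in C) (i \in A))%N.
  rewrite -sum1_card big_mkcond [RHS]big_mkcond; apply: eq_bigr => i _.
  by rewrite inE; case: (i \in A); case: (i \in C).
under eq_bigr do rewrite cardI.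
rewrite exchange_big; apply: eq_bigr => j _.
by rewrite cardI; apply: eq_bigr => v _; rewrite !inE.
Qed.

(** The counting core: out-degree at most [d * D] leaves [k j] room for one more child within the
    allowance [d * D + 1]. *)
Lemma exists_unsaturated_source G H (B : {set 'I_p}) (k : 'I_p -> 'I_p)
    (d D : nat) :
  (0 < D)%N -> B != set0 ->
  {in B, forall j, (k j, j) \in H} ->
  {in ~: B, forall j, Pa G j = Pa H j} ->
  (forall j, #|Pa G j| <= D)%N ->
  (forall v, #|Ch H v| <= d)%N ->
  exists2 j, j \in B & (#|Ch G (k j)| <= d * D)%N.
Proof.
move=> D_gt0 /set0Pn[j0 Bj0] kH eqGH degG degH.
apply/exists_inP; apply: contraT => /exists_inPn satur.
pose K := k @: B.
have K_gt0 : (0 < #|K|)%N by apply/card_gt0P; exists (k j0); apply: imset_f.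
have B_le : (#|B| <= \sum_(v in K) #|Ch H v :&: B|)%N.
  rewrite sum_card_Ch_Pa -sum1_card; apply: leq_sum => j Bj.
  by apply/card_gt0P; exists (k j); rewrite !inE kH //= imset_f.
have GB_le : (\sum_(v in K) #|Ch G v :&: B| <= #|B| * D)%N.
  rewrite sum_card_Ch_Pa -sum_nat_const; apply: leq_sum => j _.
  exact: leq_trans (subset_leq_card (subsetIl _ _)) (degG j).
have H_le : (\sum_(v in K) #|Ch H v| <= #|K| * d)%N.
  by rewrite -sum_nat_const; apply: leq_sum.
have G_ge : (#|K| * (d * D).+1 <= \sum_(v in K) #|Ch G v|)%N.
  rewrite -sum_nat_const; apply: leq_sum => _ /imsetP[j Bj ->].
  by rewrite ltnNge satur.
have ChE F : (\sum_(v in K) #|Ch F v| = \sum_(v in K) #|Ch F v :&: B| +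
    \sum_(v in K) #|Ch F v :\: B|)%N.
  by rewrite -big_split /=; apply: eq_bigr => v _; rewrite cardsID.
have offB : (\sum_(v in K) #|Ch G v :\: B| = \sum_(v in K) #|Ch H v :\: B|)%N.
  apply: eq_bigr => v _; apply: eq_card => j; rewrite !inE.
  case Bj: (j \in B) => //=.
  have /setP/(_ v) : Pa G j = Pa H j by apply: eqGH; rewrite inE Bj.
  by rewrite !inE.
(* Let [x] and [y] count the edges of [H] from [K] into [B] and out of [B]. Then [G] has at most
   [#|B| * D + y <= x * D + y <= (x + y) * D <= #|K| * d * D] edges leaving [K], where [y <= y * D]
   because [0 < D]. As [K] is nonempty, this contradicts [G_ge]. *)
move: H_le G_ge; rewrite !ChE offB; nia.
Qed.

Lemma ordered_dagP s G :
  ordered_dag s G <-> forall j, Pa G j \subset preds s j.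
Proof.
split=> [[dagG ordG] j | sub].
  apply/subsetP => k; rewrite !inE => kj; case: ltngtP => //.
    by move=> /ordG; rewrite !permKV kj.
  (* Equal positions mean a self-loop, which acyclicity excludes. *)
  move=> /val_inj/perm_inj eqkj; subst k.
  by have := dagG [:: j] isT; rewrite /edge /= kj.
have lt_edge a b : edge G a b -> ((s^-1)%g a < (s^-1)%g b)%N.
  by move=> ab; have /subsetP/(_ a) := sub b; rewrite !inE; apply.
split=> [[//|x c] _ | i j ltij].
  apply/negP => cyc.
  have lt_trans : transitive [rel a b | ((s^-1)%g a < (s^-1)%g b)%N].
    by move=> b a c' /=; apply: ltn_trans.
  (* Positions increase along edges, so by transitivity every later vertex of the closed walk,
     including the final [x], comes strictly after [x]. *)
  have := sub_path lt_edge cyc.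
  move=> /(order_path_min lt_trans)/allP/(_ x).
  by rewrite mem_rcons mem_head /= ltnn => /(_ isT).
by apply/negP => /lt_edge; rewrite !permK ltnNge ltnW.
Qed.

Lemma minimal_imap_sub_preds H s j : Pa (minimal_imap H s) j \subset preds s j.
Proof.
apply/subsetP => k; rewrite !inE => /imset2P[a b _].
by rewrite !inE /= => /andP[ltab _] [-> ->]; rewrite !permK.
Qed.

Lemma Pa_update g j G i :
  Pa (update_parents g j G) i = if i == j then g j (Pa G j) else Pa G i.
Proof. by apply/setP => k; rewrite !inE /=; case: eqP; rewrite ?inE. Qed.

Lemma Ch_update_sub g j G v :
  Ch (update_parents g j G) v \subset
    (if v \in g j (Pa G j) then j |: Ch G v else Ch G v).
Proof.
apply/subsetP => i; rewrite inE !inE /=.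
by case: eqP => [-> vg | _ vi]; [rewrite vg setU11 | case: ifP; rewrite !inE vi ?orbT].
Qed.

End Digraphs.

(** Reduces a move to its shape, forgetting the score: additions and swaps share the second
    alternative, where the one new parent comes from [Sstar]. *)
Lemma ads_stepP (R : realType) (p : nat) (f : {set 'I_p} -> R) (d_in : nat)
    (Sstar S S' : {set 'I_p}) :
  S <> Sstar -> (#|S| <= d_in)%N -> ads_step f d_in Sstar S S' ->
  S' \proper S \/
  exists k, [/\ k \in Sstar :\: S, k \in S', S' \subset k |: S
              & (#|S'| <= d_in)%N].
Proof.
move=> neqS leS []; first by [].
- move=> l _ [lS _]; left; apply: properD1.
  by move: lS; rewrite inE => /andP[].
- move=> k _ ltS [kS _]; right; exists k; split=> //; first exact: setU11.
  by rewrite cardsU1; move: kS; rewrite inE => /andP[-> _].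
- move=> k l _ eqS [/setXP[/= kS lS] _]; right; exists k.
  have [/setDP[_ kNS] /setDP[Sl _]] := (kS, lS); split=> //.
  + by rewrite !inE eqxx andbT; apply: contraNneq kNS => ->.
  + exact: subsetDl.
  (* A swap preserves cardinality, since [k] lies outside [S] and [l] inside. *)
  + have := cardsD1 l (k |: S); rewrite cardsU1 kNS !inE Sl orbT.
    by rewrite eqS => /addnI <-.
Qed.

Theorem lemma2 (R : realType) (p : nat) (Gstar : digraph p) (s : 'S_p)
    (psi : digraph p -> R) (psi_ : 'I_p -> {set 'I_p} -> R)
    (d_in d_out : nat) (g : 'I_p -> {set 'I_p} -> {set 'I_p}) :
  is_dag Gstar ->
  decomposable psi psi_ ->
  score_equivalent psi ->
  (1 <= d_in <= p)%N ->
  (1 <= d_out <= p)%N ->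
  let d_star := max_degree (minimal_imap Gstar s) in
  (d_star <= d_in)%N ->
  (minn (d_star * d_in + 1) p <= d_out)%N ->
  is_ads_operator psi_ s d_in Gstar g ->
  forall G : digraph p,
    bounded_ordered_dag s d_in d_out G ->
    G <> minimal_imap Gstar s ->
    exists j : 'I_p,
      bounded_ordered_dag s d_in d_out (update_parents g j G) /\
      update_parents g j G <> G.
Proof.
move=> _ _ _ /andP[d_in_gt0 _] _ d_star le_d_star le_d_out ads G
  [/ordered_dagP ordG /bigmax_leqP inG /bigmax_leqP outG] neqG.
set H := minimal_imap Gstar s in d_star le_d_star le_d_out neqG ads *.
have candG j : Pa G j \in cand_parents s j d_in by rewrite inE ordG inG.
pose B := [set j | Pa G j != Pa H j].
have B_neq0 : B != set0.
  apply: contra_notN neqG => /eqP B0; apply/setP => -[k j].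
  have : j \notin B by rewrite B0 inE.
  by rewrite inE negbK => /eqP/setP/(_ k); rewrite !inE.
have stepB j : j \in B -> g j (Pa G j) \proper Pa G j \/
    exists k, [/\ k \in Pa H j :\: Pa G j, k \in g j (Pa G j),
      g j (Pa G j) \subset k |: Pa G j & (#|g j (Pa G j)| <= d_in)%N].
  by rewrite inE => /eqP neqj; apply: ads_stepP neqj (inG j isT) (ads _ _ (candG j)).
have neq_update j : g j (Pa G j) <> Pa G j -> update_parents g j G <> G.
  by move=> neqj /(congr1 (@Pa p ^~ j)); rewrite Pa_update eqxx.
have bounded_update j :
    g j (Pa G j) \subset preds s j -> (#|g j (Pa G j)| <= d_in)%N ->
    (forall v, #|Ch (update_parents g j G) v| <= d_out)%N ->
    bounded_ordered_dag s d_in d_out (update_parents g j G).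
  move=> ordj inj outj; split.
  - by apply/ordered_dagP => i; rewrite Pa_update; case: eqP => [->|].
  - by apply/bigmax_leqP => i _; rewrite Pa_update; case: eqP => // _; apply: inG.
  - exact/bigmax_leqP.
have [/exists_inP[j Bj delj] | /exists_inPn noDel] :=
    boolP [exists j in B, g j (Pa G j) \proper Pa G j].
  have sub := proper_sub delj; exists j; split.
    apply: bounded_update => [||v].
    - exact: subset_trans sub (ordG j).
    - exact: leq_trans (subset_leq_card sub) (inG j isT).
    - apply: leq_trans (outG v isT); apply: subset_leq_card.
      apply: subset_trans (Ch_update_sub _ _ _ _) _.
      (* A parent kept by the deletion already had [j] as a child, so no out-degree grows. *)
      case: ifP => // /(subsetP sub); rewrite inE => vj.
      by rewrite subUset sub1set inE vj /=.
  by apply: neq_update => eqj; rewrite eqj properxx in delj.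
have /choice[k kP] j : exists k, j \in B ->
    [/\ k \in Pa H j :\: Pa G j, k \in g j (Pa G j),
      g j (Pa G j) \subset k |: Pa G j & (#|g j (Pa G j)| <= d_in)%N].
  (* Outside [B] the value [j] is an arbitrary default. *)
  have [Bj | _] := boolP (j \in B); last by exists j.
  case: (stepB j Bj) => [delj | [k kP]]; last by exists k.
  by have := noDel j Bj; rewrite delj.
(* Only [k j] can gain a child in the move at [j], so its out-degree is the only one left to
   control. *)
suff [j Bj out_kj] : exists2 j, j \in B &
    (#|Ch (update_parents g j G) (k j)| <= d_out)%N.
  have [kHG kg sub lej] := kP j Bj; move: (kHG); rewrite !inE => /andP[kNG kH].
  exists j; split.
    apply: bounded_update => // [|v].
      apply: subset_trans sub _; rewrite subUset ordG andbT sub1set.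
      by apply: (subsetP (minimal_imap_sub_preds Gstar s j)); rewrite inE.
    have [-> // | neqv] := eqVneq v (k j).
    apply: leq_trans (outG v isT); apply: subset_leq_card.
    apply: subset_trans (Ch_update_sub _ _ _ _) _.
    case: ifP => // /(subsetP sub); rewrite !inE (negPf neqv) /= => vj.
    by rewrite subUset sub1set inE vj /=.
  by apply: neq_update => eqj; rewrite eqj inE (negPf kNG) in kg.
(* If the minimum is [p], the out-degree bound is trivial and any node of [B] works. *)
move: le_d_out; rewrite geq_min => /orP[le_d_out | le_p]; last first.
  have [j Bj] := set0Pn _ B_neq0; exists j => //.
  by apply: leq_trans le_p; rewrite -[leqRHS]card_ord; apply: max_card.
have [j||||j Bj le_j] := @exists_unsaturated_source p G H B k d_star d_in
    d_in_gt0 B_neq0.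
- by move=> /kP[]; rewrite !inE => /andP[].
- by move=> j; rewrite !inE negbK => /eqP.
- by move=> j; apply: inG.
- move=> v; apply: leq_trans (leq_bigmax v).
  by apply: subset_leq_card; apply: subsetUr.
exists j => //; apply: leq_trans le_d_out.
(* The new child [j] accounts for the [+ 1] in the bound on [d_out]. *)
apply: leq_trans (subset_leq_card (Ch_update_sub _ _ _ _)) _.
case: ifP => _; last exact: leq_trans le_j (leq_addr _ _).
by rewrite cardsU1 addnC leq_add // leq_b1.
Qed.
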